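(* Let $p$ be an odd prime number and let $s\geq 1$ be an integer. Then the domination number of the undirected zero divisor graph $\overline{\Gamma}(\mathbb{Z}_{p^{s}}[i,j,k])$ is $p+1$.
   Context: For a positive integer $n$, $\mathbb{Z}_n$ is the ring of integers modulo $n$, and $\mathbb{Z}_{n}[i,j,k]=\{a+bi+cj+dk\mid a,b,c,d\in\mathbb{Z}_n\}$ is the ring of Lipschitz quaternions modulo $n$, with the usual quaternion multiplication ($i^2=j^2=k^2=ijk=-1$). For a ring $R$ with identity, $Z^{*}(R)$ is the set of non-zero zero divisors of $R$ (elements that are left or right zero divisors). The undirected zero divisor graph $\overline{\Gamma}(R)$ has vertex set $Z^{*}(R)$, and distinct vertices $a$ and $b$ are adjacent if and only if $ab=0$ or $ba=0$. A dominating set of a graph $G$ is a subset $S$ of the vertices such that every vertex not in $S$ is adjacent to at least one vertex of $S$; the domination number of $G$ is the minimum number of vertices in a dominating set. *)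

(* Defs.v *)
From HB Require Import structures.
From mathcomp Require Import all_boot all_order all_algebra ring.

Set Implicit Arguments.
Unset Strict Implicit.
Unset Printing Implicit Defensive.

Import GRing.Theory.
Local Open Scope ring_scope.

(* Quat a b c d is a + b i + c j + d k *)
Record quaternion (R : Type) : Type :=
  Quat { qre : R; qi : R; qj : R; qk : R }.

Section Encoding.

Variable R : Type.

Definition tuple_of_quat (x : quaternion R) : R * R * R * R :=
  (qre x, qi x, qj x, qk x).

Definition quat_of_tuple (t : R * R * R * R) : quaternion R :=
  Quat t.1.1.1 t.1.1.2 t.1.2 t.2.

Lemma tuple_of_quatK : cancel tuple_of_quat quat_of_tuple.
Proof. by case. Qed.

End Encoding.

HB.instance Definition _ (R : eqType) :=
  Equality.copy (quaternion R) (can_type (@tuple_of_quatK R)).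
HB.instance Definition _ (R : choiceType) :=
  Choice.copy (quaternion R) (can_type (@tuple_of_quatK R)).
HB.instance Definition _ (R : countType) :=
  Countable.copy (quaternion R) (can_type (@tuple_of_quatK R)).
HB.instance Definition _ (R : finType) :=
  Finite.copy (quaternion R) (can_type (@tuple_of_quatK R)).

Section QuaternionRing.

Variable R : comNzRingType.
Implicit Types x y z : quaternion R.

Definition quat_add x y :=
  Quat (qre x + qre y) (qi x + qi y) (qj x + qj y) (qk x + qk y).

Definition quat_opp x := Quat (- qre x) (- qi x) (- qj x) (- qk x).

Definition quat_zero : quaternion R := Quat 0 0 0 0.

Definition quat_one : quaternion R := Quat 1 0 0 0.

Definition quat_mul x y :=
  Quat (qre x * qre y - qi x * qi y - qj x * qj y - qk x * qk y)
       (qre x * qi y + qi x * qre y + qj x * qk y - qk x * qj y)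
       (qre x * qj y - qi x * qk y + qj x * qre y + qk x * qi y)
       (qre x * qk y + qi x * qj y - qj x * qi y + qk x * qre y).

Lemma quat_addA : associative quat_add.
Proof. by case=> ? ? ? ? [????] [????]; rewrite /quat_add /= !addrA. Qed.

Lemma quat_addC : commutative quat_add.
Proof. by case=> ? ? ? ? [????]; rewrite /quat_add /=; congr Quat; rewrite addrC. Qed.

Lemma quat_add0l : left_id quat_zero quat_add.
Proof. by case=> *; rewrite /quat_add /= !add0r. Qed.

Lemma quat_addNl : left_inverse quat_zero quat_opp quat_add.
Proof. by case=> *; rewrite /quat_add /= !addNr. Qed.

HB.instance Definition _ :=
  GRing.isZmodule.Build (quaternion R) quat_addA quat_addC quat_add0l quat_addNl.

Lemma quat_mulA : associative quat_mul.
Proof. by case=> ? ? ? ? [????] [????]; congr Quat; rewrite /=; ring. Qed.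

Lemma quat_mul1l : left_id quat_one quat_mul.
Proof. by case=> *; congr Quat; rewrite /=; ring. Qed.

Lemma quat_mul1r : right_id quat_one quat_mul.
Proof. by case=> *; congr Quat; rewrite /=; ring. Qed.

Lemma quat_mulDl : left_distributive quat_mul quat_add.
Proof. by case=> ? ? ? ? [????] [????]; congr Quat; rewrite /=; ring. Qed.

Lemma quat_mulDr : right_distributive quat_mul quat_add.
Proof. by case=> ? ? ? ? [????] [????]; congr Quat; rewrite /=; ring. Qed.

Lemma quat_one_neq0 : quat_one != 0.
Proof. by apply/eqP=> -[] /eqP; rewrite oner_eq0. Qed.

HB.instance Definition _ :=
  GRing.Zmodule_isNzRing.Build (quaternion R)
    quat_mulA quat_mul1l quat_mul1r quat_mulDl quat_mulDr quat_one_neq0.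

Definition quat_i : quaternion R := Quat 0 1 0 0.
Definition quat_j : quaternion R := Quat 0 0 1 0.
Definition quat_k : quaternion R := Quat 0 0 0 1.

Lemma quaternion_relations :
  [/\ quat_i * quat_i = -1, quat_j * quat_j = -1, quat_k * quat_k = -1 & quat_i * quat_j * quat_k = -1].
Proof. by split; congr Quat; rewrite /=; ring. Qed.

Lemma quaternionE (a b c d : R) :
  Quat a b c d = Quat a 0 0 0 + Quat b 0 0 0 * quat_i + Quat c 0 0 0 * quat_j
                 + Quat d 0 0 0 * quat_k.
Proof. by congr Quat; rewrite /=; ring. Qed.

End QuaternionRing.

(* Without this the finNzRingType structure of quaternion R is not inferred. *)
HB.instance Definition _ (R : finComNzRingType) :=
  Finite.on (quaternion R).

Section ZeroDivisorGraph.

Variable R : finNzRingType.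

Definition left_zero_divisor (a : R) : bool :=
  [exists b : R, (b != 0) && (a * b == 0)].

Definition right_zero_divisor (a : R) : bool :=
  [exists b : R, (b != 0) && (b * a == 0)].

Definition nonzero_zero_divisor (a : R) : bool :=
  (a != 0) && (left_zero_divisor a || right_zero_divisor a).

Definition zero_divisor_vertex : finType := {a : R | nonzero_zero_divisor a}.

Definition zero_divisor_adj : rel zero_divisor_vertex :=
  fun a b => (a != b) && ((val a * val b == 0) || (val b * val a == 0)).

End ZeroDivisorGraph.

Section Domination.

Variables (V : finType) (adj : rel V).

Definition dominating (S : {set V}) : bool :=
  [forall v : V, (v \notin S) ==> [exists u in S, adj v u]].

Lemma dominating_setT : dominating [set: V].
Proof. by apply/forallP=> v; rewrite inE. Qed.

Definition domination_number : nat :=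
  #|[arg min_(S < [set: V] | dominating S) #|S|]|.

End Domination.

(* Main.v *)
(* Write Q for the quaternions over Z/p^s. Since -1 is a sum of two squares
   modulo p, the reduction H of Q modulo p is the ring of 2 x 2 matrices over F_p,
   and its nonzero zero divisors are the matrices of rank one, with a kernel and
   an image in the projective line, which has p + 1 points.

   Multiplication by p^(s-1) embeds H in Q, and Q acts on this copy of H through
   reduction. Every vertex v reduces to a singular matrix, hence kills p^(s-1) x
   for any lift x of a matrix whose image lies in the kernel of v mod p: one x
   for each of the p + 1 images gives a dominating set.

   Conversely, each u <> 0 has a nonzero w in H such that vu = 0 implies
   (v mod p) w = 0, and similarly on the left (w = u mod p when that is nonzero). So a dominating set of size at
   most p would yield a set W of at most p nonzero matrices such that each rank
   one matrix is in W or annihilates, on one side, an element of W. Some line M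
   is not the kernel of any element of W, and some line L0 is not the image of
   any. If L is not the image of an element of W, the matrices with kernel L and
   image M must belong to W. Choosing one of those for such L, and an element of
   W with image L for the other L (for L = M, one with kernel L0), one gets p + 1
   distinct elements of W; distinctness at L = M uses the two matrices e and -e,
   which differ as p is odd. *)
Require Import Defs.
From mathcomp Require Import all_boot all_order all_algebra ring.

Set Implicit Arguments.
Unset Strict Implicit.
Unset Printing Implicit Defensive.

Import GRing.Theory.
Local Open Scope ring_scope.

(** * Conjugation, norm and scalars for quaternions over a commutative ring *)

Definition quat_scalar (R : comNzRingType) (c : R) : quaternion R := Quat c 0 0 0.

Definition quat_conj (R : comNzRingType) (x : quaternion R) : quaternion R :=
  Quat (qre x) (- qi x) (- qj x) (- qk x).

Definition quat_norm (R : comNzRingType) (x : quaternion R) : R :=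
  qre x ^+ 2 + qi x ^+ 2 + qj x ^+ 2 + qk x ^+ 2.

Section Quaternion.

Variable R : comNzRingType.
Implicit Types x : quaternion R.

Lemma quat_conj_mul x : quat_conj x * x = quat_scalar (quat_norm x).
Proof. by case: x => a b c d; congr Quat; rewrite /quat_norm /=; ring. Qed.

Lemma quat_mul_conj x : x * quat_conj x = quat_scalar (quat_norm x).
Proof. by case: x => a b c d; congr Quat; rewrite /quat_norm /=; ring. Qed.

Lemma quat_scalar_comm (c : R) x : x * quat_scalar c = quat_scalar c * x.
Proof. by case: x => ????; congr Quat; rewrite /=; ring. Qed.

Lemma quat_scalarE (c : R) x :
  quat_scalar c * x = Quat (c * qre x) (c * qi x) (c * qj x) (c * qk x).
Proof. by case: x => ????; congr Quat; rewrite /=; ring. Qed.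

Lemma quat_mulrn x n :
  x *+ n = Quat (qre x *+ n) (qi x *+ n) (qj x *+ n) (qk x *+ n).
Proof.
elim: n => [|n IHn]; first by rewrite !mulr0n.
by rewrite !mulrSr IHn.
Qed.

End Quaternion.

Section Field.

Variable F : fieldType.
Implicit Types x y : quaternion F.

Lemma quat_scalar_mul_eq0 (c : F) x :
  (quat_scalar c * x == 0) = (c == 0) || (x == 0).
Proof.
apply/eqP/orP=> [|[/eqP->|/eqP->]]; last by rewrite mulr0.
  rewrite quat_scalarE; case: x => a b d e /= [].
  case: eqP => [_|/eqP c0]; first by left.
  do 4![move/eqP; rewrite mulf_eq0 (negPf c0) /= => /eqP->]; by right.
by rewrite quat_scalarE !mul0r.
Qed.

(** Multiplying [x * y = 0] on the left by the conjugate of [x] leaves the norm of [x] times [y]. *)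
Lemma quat_norm_eq0_mulr x y : y != 0 -> x * y = 0 -> quat_norm x = 0.
Proof.
move=> y0 xy0; apply/eqP; move: (quat_scalar_mul_eq0 (quat_norm x) y).
by rewrite -quat_conj_mul -mulrA xy0 mulr0 eqxx (negPf y0) orbF.
Qed.

Lemma quat_norm_eq0_mull x y : y != 0 -> y * x = 0 -> quat_norm x = 0.
Proof.
move=> y0 yx0; apply/eqP; move: (quat_scalar_mul_eq0 (quat_norm x) y).
by rewrite -quat_scalar_comm -quat_mul_conj mulrA yx0 mul0r eqxx (negPf y0) orbF.
Qed.

End Field.

(** * Quaternions over a split field as 2 x 2 matrices; rank one elements *)

Section Split.

Variables (F : fieldType) (al be : F).
Hypotheses (two_neq0 : (2 : F) != 0) (al_be : al * al = -1 - be * be).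
Implicit Types (x y w : quaternion F) (L M N : option F).

(* Twice the quaternion of the matrix [u v^T], under the isomorphism that maps
   [i] to [[al, be], [be, - al]] and [j] to [[0, -1], [1, 0]]. *)
Definition rank_one (u v : F * F) : quaternion F :=
  let: (m11, m12, m21, m22) := (u.1 * v.1, u.1 * v.2, u.2 * v.1, u.2 * v.2) in
  Quat (m11 + m22) (- (al * (m11 - m22) + be * (m12 + m21)))
       (m21 - m12) (- (be * (m11 - m22) - al * (m12 + m21))).

(** In matrices, [(u v^T)(u' v'^T) = (v . u') u v'^T]; the factor 2 comes from the doubling in
    [rank_one]. *)
Lemma mul_rank_one u v u' v' :
  rank_one u v * rank_one u' v' =
  quat_scalar (2 * (v.1 * u'.1 + v.2 * u'.2)) * rank_one u v'.
Proof.
by case: u v u' v' => [u1 u2] [v1 v2] [u1' u2'] [v1' v2'];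
  congr Quat; rewrite /=; ring: al_be.
Qed.

(* The image of [x] under the same isomorphism, applied to [u]. *)
Definition quat_act x (u : F * F) : F * F :=
  let: Quat a b c d := x in
  ((a + b * al + d * be) * u.1 + (b * be - c - d * al) * u.2,
   (b * be + c - d * al) * u.1 + (a - b * al - d * be) * u.2).

Lemma mul_quat_rank_one x u v : x * rank_one u v = rank_one (quat_act x u) v.
Proof.
by case: x u v => [a b c d] [u1 u2] [v1 v2]; congr Quat; rewrite /=; ring: al_be.
Qed.

Lemma rank_one_eq0 u v : (rank_one u v == 0) = (u == 0) || (v == 0).
Proof.
case: u v => [u1 u2] [v1 v2]; apply/eqP/idP => [|/orP[]/eqP[-> ->]]; last first.
- by congr Quat; rewrite /=; ring.
- by congr Quat; rewrite /=; ring.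
case=> /= h1 h2 h3 h4.
have dbl0 (m : F) : 2 * m = 0 -> m = 0.
  by move/eqP; rewrite mulf_eq0 (negPf two_neq0) => /eqP.
(* The combinations of coordinates below are the matrix entries of the quaternion, each equal to
   [2 * (ui * vj)]. *)
have m11 : u1 * v1 = 0.
  apply: dbl0; transitivity ((u1 * v1 + u2 * v2) +
    (al * (- (al * (u1 * v1 - u2 * v2) + be * (u1 * v2 + u2 * v1))) +
     be * (- (be * (u1 * v1 - u2 * v2) - al * (u1 * v2 + u2 * v1))))).
    by ring: al_be.
  by rewrite h1 h2 h4; ring.
have m12 : u1 * v2 = 0.
  apply: dbl0; transitivity (- (u2 * v1 - u1 * v2) +
    (be * (- (al * (u1 * v1 - u2 * v2) + be * (u1 * v2 + u2 * v1))) -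
     al * (- (be * (u1 * v1 - u2 * v2) - al * (u1 * v2 + u2 * v1))))).
    by ring: al_be.
  by rewrite h3 h2 h4; ring.
have m22 : u2 * v2 = 0 by rewrite -h1 m11 add0r.
have m21 : u2 * v1 = 0 by rewrite -h3 m12 subr0.
apply: contraT; rewrite negb_or -!pair_eqE /= !negb_and.
move/eqP: m11; move/eqP: m12; move/eqP: m21; move/eqP: m22.
rewrite !mulf_eq0.
by case: (u1 == 0); case: (u2 == 0); case: (v1 == 0); case: (v2 == 0).
Qed.

(** The projective line is encoded as [option F]: [Some t] is the point (1 : t), [None] the point at
    infinity (0 : 1). *)
Definition proj_vec L : F * F := if L is Some t then (1, t) else (0, 1).

Definition proj_det L M : F :=
  (proj_vec L).1 * (proj_vec M).2 - (proj_vec L).2 * (proj_vec M).1.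

(* Has kernel [L] and image [M]. *)
Definition line_map L M : quaternion F :=
  rank_one (proj_vec M) (- (proj_vec L).2, (proj_vec L).1).

Lemma proj_det_eq0 L M : (proj_det L M == 0) = (L == M).
Proof.
case: L M => [t|] [r|]; rewrite /proj_det /= ?(mul1r, mulr1, mul0r, mulr0, subr0, sub0r).
- by rewrite subr_eq0 eq_sym.
- by rewrite oner_eq0.
- by rewrite oppr_eq0 oner_eq0.
- by rewrite !eqxx.
Qed.

Lemma proj_vec_neq0 L : proj_vec L != 0.
Proof.
by case: L => [t|]; rewrite -pair_eqE /= negb_and oner_neq0 ?orbT.
Qed.

Lemma line_map_neq0 L M : line_map L M != 0.
Proof.
rewrite rank_one_eq0 (negPf (proj_vec_neq0 M)) /=.
by case: L => [t|]; rewrite -pair_eqE /= negb_and ?oppr_eq0 oner_neq0 ?orbT.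
Qed.

Lemma line_map_mul L M L' M' :
  line_map L M * line_map L' M' =
  quat_scalar (2 * proj_det L M') * line_map L' M.
Proof.
by rewrite mul_rank_one /=; congr (quat_scalar (2 * _) * _); rewrite /proj_det; ring.
Qed.

Lemma line_map_mul_eq0 L M L' M' :
  (line_map L M * line_map L' M' == 0) = (L == M').
Proof.
rewrite line_map_mul quat_scalar_mul_eq0 mulf_eq0 (negPf two_neq0) /=.
by rewrite proj_det_eq0 (negPf (line_map_neq0 _ _)) orbF.
Qed.

(** For [L != M] the difference is an invertible scalar, so a quaternion annihilating both terms on
    one side is zero. *)
Lemma line_mapB L M :
  line_map L M - line_map M L = quat_scalar (2 * proj_det L M).
Proof.
by congr Quat; rewrite /proj_det /=; ring.
Qed.

Lemma ex_neq L : exists M, L != M.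
Proof. by case: L => [t|]; [exists None | exists (Some 0)]. Qed.

(** Whether [w] kills a rank one map from the left depends only on its image: multiplying on the
    right by a map whose image [N] differs from the kernel changes the kernel at will, up to a
    nonzero scalar. *)
Lemma mulr_line_map_eq0 w L L' M :
  (w * line_map L M == 0) = (w * line_map L' M == 0).
Proof.
suff imp K K' : w * line_map K M = 0 -> w * line_map K' M = 0.
  by apply/eqP/eqP; apply: imp.
have [N KN] := ex_neq K => wK; apply/eqP.
have := quat_scalar_mul_eq0 (2 * proj_det K N) (w * line_map K' M).
rewrite mulf_eq0 (negPf two_neq0) proj_det_eq0 (negPf KN) /= => <-.
by rewrite mulrA -quat_scalar_comm -mulrA -line_map_mul mulrA wK mul0r.
Qed.

Lemma mull_line_map_eq0 w L M M' :
  (line_map L M * w == 0) = (line_map L M' * w == 0).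
Proof.
suff imp K K' : line_map L K * w = 0 -> line_map L K' * w = 0.
  by apply/eqP/eqP; apply: imp.
have [N KN] := ex_neq K => wK; apply/eqP.
have := quat_scalar_mul_eq0 (2 * proj_det N K) (line_map L K' * w).
rewrite mulf_eq0 (negPf two_neq0) proj_det_eq0 (eq_sym N) (negPf KN) /= => <-.
by rewrite mulrA -line_map_mul -mulrA wK mulr0.
Qed.

(** If [M != M'], the kernels can be changed to [M'] and [M]; then [w] kills the difference of the
    two maps, a nonzero scalar. *)
Lemma mulr_line_map_inj w L L' M M' :
  w != 0 -> w * line_map L M = 0 -> w * line_map L' M' = 0 -> M = M'.
Proof.
move=> w0 /eqP wM /eqP wM'; apply/eqP; apply: contraR w0 => MM'.
rewrite (mulr_line_map_eq0 _ _ M') in wM.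
rewrite (mulr_line_map_eq0 _ _ M) in wM'.
have := quat_scalar_mul_eq0 (2 * proj_det M M') w.
rewrite mulf_eq0 (negPf two_neq0) proj_det_eq0 (negPf MM') /= => <-.
by rewrite -quat_scalar_comm -line_mapB mulrBr (eqP wM) (eqP wM') subrr.
Qed.

Lemma mull_line_map_inj w L L' M M' :
  w != 0 -> line_map L M * w = 0 -> line_map L' M' * w = 0 -> L = L'.
Proof.
move=> w0 /eqP wL /eqP wL'; apply/eqP; apply: contraR w0 => LL'.
rewrite (mull_line_map_eq0 _ _ _ L') in wL.
rewrite (mull_line_map_eq0 _ _ _ L) in wL'.
have := quat_scalar_mul_eq0 (2 * proj_det L L') w.
rewrite mulf_eq0 (negPf two_neq0) proj_det_eq0 (negPf LL') /= => <-.
by rewrite -line_mapB mulrBl (eqP wL) (eqP wL') subrr.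
Qed.

Lemma line_map_inj L L' M M' :
  line_map L M = line_map L' M' -> L = L' /\ M = M'.
Proof.
move=> e; split; apply/eqP.
  by rewrite -(line_map_mul_eq0 L M L L') e line_map_mul_eq0.
by rewrite -(line_map_mul_eq0 M M L' M') -e line_map_mul_eq0.
Qed.

Lemma proj_vecP (u : F * F) : u != 0 ->
  exists c M, c != 0 /\ u = (c * (proj_vec M).1, c * (proj_vec M).2).
Proof.
case: u => u1 u2; have [->|u1N0] := eqVneq u1 0.
  rewrite -pair_eqE /= eqxx /= => u2N0.
  by exists u2, None; rewrite mulr0 mulr1.
by exists u1, (Some (u2 / u1)); rewrite /= mulr1 mulrC divfK.
Qed.

Lemma ex_mulr_line_map x L :
  quat_norm x = 0 -> exists M, x * line_map L M = 0.
Proof.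
suff act0 u : u != 0 -> quat_act x u = 0 -> exists M, x * line_map L M = 0.
  case: x act0 => a b c d act0 x0.
  pose x12 := b * be - c - d * al; pose x11 := a + b * al + d * be.
  pose x22 := a - b * al - d * be; pose x21 := b * be + c - d * al.
  (* The norm is the determinant of the matrix of [x]. *)
  have det0 : x11 * x22 - x12 * x21 = 0.
    by rewrite -[RHS]x0 /quat_norm /x11 /x22 /x12 /x21 /=; ring: al_be.
  (* A vector orthogonal to one nonzero row lies in the kernel, as the determinant vanishes; if both
     rows are zero, any vector does. *)
  have [u0|uN0] := eqVneq (x12, - x11) 0; last first.
    apply: (act0 _ uN0); congr pair; rewrite /= -/x11 -/x12 -/x21 -/x22.
      by ring.
    by rewrite -[RHS]oppr0 -det0; ring.
  have [v0|vN0] := eqVneq (x22, - x21) 0; last first.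
    apply: (act0 _ vN0); congr pair; rewrite /= -/x11 -/x12 -/x21 -/x22.
      by rewrite -det0; ring.
    by ring.
  have [x12_0 /eqP] := u0; rewrite oppr_eq0 => /eqP x11_0.
  have [x22_0 /eqP] := v0; rewrite oppr_eq0 => /eqP x21_0.
  apply: (act0 (1, 1)); first by rewrite -pair_eqE /= negb_and oner_neq0.
  by congr pair; rewrite /= -/x11 -/x12 -/x21 -/x22
    ?x11_0 ?x12_0 ?x21_0 ?x22_0; ring.
move=> /proj_vecP[c [M [c0 ->]]] xu; exists M; apply/eqP.
have := quat_scalar_mul_eq0 c (x * line_map L M); rewrite (negPf c0) /= => <-.
rewrite mulrA -quat_scalar_comm -mulrA.
set v := (- (proj_vec L).2, (proj_vec L).1).
have -> : quat_scalar c * line_map L M =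
    rank_one (c * (proj_vec M).1, c * (proj_vec M).2) v.
  by congr Quat; rewrite /=; ring.
by rewrite mul_quat_rank_one xu rank_one_eq0 eqxx.
Qed.

End Split.

(** * Counting: the lower bound over a finite field *)

Lemma leq_card_inj_set (T U : finType) (W : {set U}) (f : T -> U) :
  injective f -> (forall t, f t \in W) -> (#|T| <= #|W|)%N.
Proof.
move=> finj fW; rewrite -cardsT -(card_imset _ finj); apply: subset_leq_card.
by apply/subsetP=> _ /imsetP[t _ ->].
Qed.

(** Otherwise choosing a related [w] for each [t] would inject [T] into [W]. *)
Lemma ex_unrelated (T U : finType) (W : {set U}) (r : T -> U -> bool) :
  (forall w t t', w \in W -> r t w -> r t' w -> t = t') -> (#|W| < #|T|)%N ->
  exists t, forall w, w \in W -> ~~ r t w.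
Proof.
move=> r_fun ltWT.
have [/existsP[t /forall_inP rt]|] :=
    boolP [exists t, [forall w in W, ~~ r t w]]; first by exists t.
rewrite negb_exists => /forallP ex_r.
have {ex_r} /fin_all_exists[f f_r] t : exists w, w \in W /\ r t w.
  by have := ex_r t; rewrite negb_forall_in => /exists_inP[w wW /negPn]; exists w.
move: ltWT; rewrite ltnNge (@leq_card_inj_set _ _ _ f) // => [t t' ftt'|t].
  by apply: (r_fun (f t)); rewrite ?ftt' ?(f_r _).1 ?(f_r _).2 -?ftt' ?(f_r _).2.
by have [] := f_r t.
Qed.

Lemma quat_norm_line_map (F : fieldType) (al be : F) L M :
  al * al = -1 - be * be -> (2 : F) != 0 -> quat_norm (line_map al be L M) = 0.
Proof.
move=> al_be two_neq0.
apply: (@quat_norm_eq0_mulr _ _ (line_map al be L L)).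
  exact: line_map_neq0.
by apply/eqP; rewrite line_map_mul_eq0.
Qed.

Lemma ex_nonadjacent (F : finFieldType) (al be : F) (W : {set quaternion F}) :
  al * al = -1 - be * be -> (2 : F) != 0 ->
  {in W, forall w, w != 0} -> (#|W| <= #|F|)%N ->
  exists x, [/\ x != 0, quat_norm x = 0, x \notin W &
    {in W, forall w, x * w != 0 /\ w * x != 0}].
Proof.
move=> al_be two_neq0 W_neq0 cardW.
pose e := line_map al be.
have ltW : (#|W| < #|{: option F}|)%N by rewrite card_option ltnS.
have [M kerM] : exists M, forall w, w \in W -> ~~ (w * e M M == 0).
  apply: ex_unrelated ltW => w M M' wW /eqP wM /eqP wM'.
  exact: (mulr_line_map_inj two_neq0 al_be (W_neq0 _ wW) wM wM').
have [L0 imL0] : exists L, forall w, w \in W -> ~~ (e L M * w == 0).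
  apply: ex_unrelated ltW => w L L' wW /eqP wL /eqP wL'.
  exact: (mull_line_map_inj two_neq0 al_be (W_neq0 _ wW) wL wL').
pose good x := [&& x != 0, quat_norm x == 0, x \notin W &
  [forall w in W, (x * w != 0) && (w * x != 0)]].
have [/existsP[x /and4P[x0 /eqP nx xW /forall_inP xw]]|] := boolP [exists x, good x].
  by exists x; split=> // w /xw /andP.
rewrite negb_exists => /forallP bad.
(* If [L] is the image of no element of [W], then both [e L M] and its opposite must lie in [W], for
   otherwise they would be [good]. *)
have inW x L : e L M = x \/ e L M = - x ->
    (forall w, w \in W -> e L M * w != 0) -> x \in W.
  move=> ex eLM; apply/negPn/negP=> xW; have/negP := bad x; apply.
  have nx : quat_norm x = quat_norm (e L M).
    by case: ex => ->; rewrite // /quat_norm /= !sqrrN.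
  have x0 : x != 0.
    have: e L M != 0 by apply: line_map_neq0.
    by case: ex => ->; rewrite ?oppr_eq0.
  rewrite /good x0 nx quat_norm_line_map // eqxx xW /=; apply/forall_inP=> w wW.
  have eLMw := eLM _ wW.
  have : w * e L M != 0 by rewrite (mulr_line_map_eq0 two_neq0 al_be _ _ M) kerM.
  by case: ex eLMw => ->; rewrite ?mulNr ?mulrN ?oppr_eq0 => -> ->.
pose missing L := [forall w in W, e L M * w != 0].
have ex_f L : exists w, w \in W /\
    if missing L then w = e L M
    else e L M * w = 0 /\ (L = M -> w = - e L0 M).
  have [/forall_inP mL|] := boolP (missing L).
    by exists (e L M); split=> //; apply: (inW _ L); auto.
  rewrite negb_forall_in => /exists_inP[w wW /negPn /eqP ew].
  have [LM|LM] := eqVneq L M; last first.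
    by exists w; split=> //; split=> // /eqP; rewrite (negPf LM).
  (* For [L = M] the choice is an element with image [M] and kernel [L0]; the sign keeps it apart
     from [e L0 M], the value chosen at [L0] when [L0] is missing. *)
  exists (- e L0 M); split.
    by apply: (inW _ L0) => //; right; rewrite opprK.
  by split=> //; rewrite mulrN LM; apply/eqP; rewrite oppr_eq0 line_map_mul_eq0.
have [f f_spec] := fin_all_exists ex_f.
suff f_inj : injective f.
  move: ltW; rewrite ltnNge (leq_card_inj_set f_inj) // => L.
  by have [] := f_spec L.
(* A common value [e L' M] has image [M], which forces [L = M], then [L' = L0] and
   [e L0 M = - e L0 M], impossible as 2 is invertible. *)
have mixed L L' : ~~ missing L -> missing L' -> f L <> f L'.
  move=> /negPf mL mL' ff; have [_] := f_spec L; have [_] := f_spec L'.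
  rewrite mL mL' => fL' [/eqP]; rewrite ff fL' line_map_mul_eq0 // => /eqP LM /(_ LM) eL.
  have /eqP : e L' M * e L' L0 = 0.
    by apply/eqP; rewrite eL mulNr oppr_eq0 line_map_mul_eq0.
  rewrite line_map_mul_eq0 // => /eqP L'L0.
  have : quat_scalar 2 * e L0 M == 0.
    have -> : quat_scalar 2 = 1 + 1 :> quaternion F.
      by congr Quat; rewrite /= ?addr0.
    by rewrite mulrDl mul1r -{1}L'L0 eL addNr.
  by rewrite quat_scalar_mul_eq0 (negPf two_neq0) (negPf (line_map_neq0 two_neq0 al_be L0 M)).
move=> L L' ff; have [fW] := f_spec L; have [_] := f_spec L'.
have [mL|mL] := boolP (missing L); have [mL'|mL'] := boolP (missing L').
- by rewrite -ff => -> /line_map_inj[].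
- by case: (mixed L' L).
- by case: (mixed L L').
rewrite -ff => -[e1 _] [e2 _].
exact: (mull_line_map_inj two_neq0 al_be (W_neq0 _ fW) e2 e1).
Qed.

(** * Writing -1 as a sum of two squares modulo p *)

Lemma Fp_two_neq0 p : prime p -> odd p -> (2 : 'F_p) != 0.
Proof.
move=> p_pr p_odd; rewrite -(dvdn_pcharf (pchar_Fp p_pr)) dvdn_prime2 //.
by apply: contraTneq p_odd => ->.
Qed.

(** Pigeonhole: the (p + 1)/2 squares and the (p + 1)/2 values -1 - b^2 cannot be disjoint among p
    residues. *)
Lemma Fp_sum_two_squares p : prime p -> odd p ->
  exists al be : 'F_p, al * al = -1 - be * be.
Proof.
move=> p_pr p_odd.
have [/exists_inP[a _ /exists_inP[b _ /eqP]]|] := boolP [exists a in 'F_p,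
    exists b in 'F_p, a * a == -1 - b * b]; first by exists a, b.
rewrite negb_exists_in => /forall_inP nsq.
(* Both factors of [j^2 - i^2 = (j - i)(j + i)] lie strictly between 0 and [p]. *)
have sqr_lt (i j : 'I_(p./2.+1)) : (i < j)%N -> i%:R * i%:R != j%:R * j%:R :> 'F_p.
  move=> ltij; rewrite eq_sym -subr_eq0.
  have -> : j%:R * j%:R - i%:R * i%:R = (j - i)%:R * (j + i)%:R :> 'F_p.
    by rewrite -!expr2 subr_sqr natrB ?natrD // ltnW.
  have lt_ji : (j + i < p)%N.
    rewrite -[X in (_ < X)%N]odd_double_half p_odd add1n ltnS -addnn.
    by rewrite leq_add // -ltnS.
  rewrite mulf_eq0 -!(dvdn_pcharf (pchar_Fp p_pr)) negb_or !gtnNdvd //.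
  - by rewrite addn_gt0 (leq_ltn_trans _ ltij).
  - by rewrite subn_gt0.
  by rewrite (leq_ltn_trans _ lt_ji) // (leq_trans (leq_subr _ _)) ?leq_addr.
have sqr_inj : injective (fun i : 'I_(p./2.+1) => (i%:R * i%:R : 'F_p)).
  move=> i j /eqP eij; apply: val_inj; apply/eqP; move: eij; apply: contraTT.
  by rewrite neq_ltn => /orP[/sqr_lt //|/sqr_lt]; rewrite eq_sym.
have f_inj : injective (fun x : 'I_(p./2.+1) + 'I_(p./2.+1) => match x with
    | inl i => i%:R * i%:R : 'F_p | inr i => -1 - i%:R * i%:R end).
  move=> [] i [] j => [/sqr_inj->//|/eqP|/esym/eqP|/addrI/oppr_inj/sqr_inj->//].
    by have /exists_inPn/(_ j%:R isT)/negPf-> := nsq i%:R isT.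
  by have /exists_inPn/(_ i%:R isT)/negPf-> := nsq j%:R isT.
have le_p : (p./2.+1 + p./2.+1 <= p)%N.
  by have := leq_card _ f_inj; rewrite card_sum card_Fp // card_ord.
suff: (p < p)%N by rewrite ltnn.
rewrite (leq_trans _ le_p) // -[X in (X < _)%N]odd_double_half p_odd -addnn.
by rewrite addSn addnS add1n.
Qed.

(** * Reduction modulo p and the socle of the quaternions over Z/p^s *)

Definition quat_map (R S : Type) (f : R -> S) (x : quaternion R) :=
  Quat (f (qre x)) (f (qi x)) (f (qj x)) (f (qk x)).

Section Reduction.

Variables p s : nat.
Hypotheses (p_prime : prime p) (s_gt0 : (0 < s)%N).

Definition Fp_of_Zp (a : 'Z_(p ^ s)) : 'F_p := (a : nat)%:R.

(** A set-theoretic section of [Fp_of_Zp], not additive in general. *)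
Definition Zp_of_Fp (a : 'F_p) : 'Z_(p ^ s) := (a : nat)%:R.

Definition reduce (x : quaternion 'Z_(p ^ s)) : quaternion 'F_p :=
  quat_map Fp_of_Zp x.

Definition qlift (x : quaternion 'F_p) : quaternion 'Z_(p ^ s) :=
  quat_map Zp_of_Fp x.

(** ['Z_n] is the ring of integers modulo [n] only when [n > 1]. *)
Let q_gt1 : (1 < p ^ s)%N.
Proof. by rewrite (ltn_exp2l 0) ?prime_gt1. Qed.

Lemma Fp_of_Zp_nat n : Fp_of_Zp n%:R = n%:R.
Proof.
rewrite /Fp_of_Zp val_Zp_nat // [in RHS](divn_eq n (p ^ s)) natrD natrM natrX.
by rewrite pchar_Fp_0 // expr0n eqn0Ngt s_gt0 mulr0 add0r.
Qed.

Lemma Fp_of_ZpD : {morph Fp_of_Zp : a b / a + b}.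
Proof.
by move=> a b; rewrite -[a]natr_Zp -[b]natr_Zp -natrD !Fp_of_Zp_nat natrD.
Qed.

Lemma Fp_of_ZpM : {morph Fp_of_Zp : a b / a * b}.
Proof.
by move=> a b; rewrite -[a]natr_Zp -[b]natr_Zp -natrM !Fp_of_Zp_nat natrM.
Qed.

Lemma Fp_of_ZpN : {morph Fp_of_Zp : a / - a}.
Proof.
by move=> a; apply/eqP; rewrite -addr_eq0 -Fp_of_ZpD addNr (Fp_of_Zp_nat 0).
Qed.

Lemma reduceM : {morph reduce : x y / x * y}.
Proof.
by move=> x y; congr Quat; rewrite /= !(Fp_of_ZpD, Fp_of_ZpN, Fp_of_ZpM).
Qed.

Lemma reduceB : {morph reduce : x y / x - y}.
Proof. by move=> x y; congr Quat; rewrite /= !(Fp_of_ZpD, Fp_of_ZpN). Qed.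

Lemma qliftK : cancel qlift reduce.
Proof. by case=> a b c d; congr Quat; rewrite /= Fp_of_Zp_nat natr_Zp. Qed.

Lemma Zp_nat_eq0 n : (n%:R == 0 :> 'Z_(p ^ s)) = (p ^ s %| n)%N.
Proof. by rewrite -val_eqE /= val_Zp_nat. Qed.

Let expn_predr : (p ^ s = p ^ s.-1.+1)%N.
Proof. by rewrite prednK. Qed.

(** On representatives, p^s divides n p^(s-1) exactly when p divides n; thus multiplication by
    p^(s-1) factors through an embedding of F_p. *)
Lemma Zp_mulrn_eq0 (a : 'Z_(p ^ s)) : (a *+ p ^ s.-1 == 0) = (Fp_of_Zp a == 0).
Proof.
rewrite -[a]natr_Zp Fp_of_Zp_nat -mulrnA Zp_nat_eq0 -(dvdn_pcharf (pchar_Fp p_prime)).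
by rewrite [X in (X %| _)%N]expn_predr expnS dvdn_pmul2r // expn_gt0 prime_gt0.
Qed.

Lemma quat_eq0 (R : comNzRingType) (x : quaternion R) :
  (x == 0) = [&& qre x == 0, qi x == 0, qj x == 0 & qk x == 0].
Proof.
case: x => a b c d; apply/eqP/and4P => [[-> -> -> ->] //|[]].
by do 4![move/eqP=> /= ->].
Qed.

Lemma quat_mulrn_eq0 x : (x *+ p ^ s.-1 == 0) = (reduce x == 0).
Proof. by rewrite quat_mulrn !quat_eq0 /= !Zp_mulrn_eq0. Qed.

Lemma Zp_mulrp_eq0 (a : 'Z_(p ^ s)) : a *+ p = 0 -> exists b, a = b *+ p ^ s.-1.
Proof.
rewrite -{1}[a]natr_Zp -mulrnA => /eqP; rewrite Zp_nat_eq0.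
rewrite [X in (X %| _)%N]expn_predr expnSr dvdn_pmul2r ?prime_gt0 // => /dvdnP[n an].
by exists n%:R; rewrite -mulrnA -an natr_Zp.
Qed.

Lemma quat_mulrp_eq0 (x : quaternion 'Z_(p ^ s)) : x *+ p = 0 -> exists y, x = y *+ p ^ s.-1.
Proof.
move=> /eqP; rewrite quat_mulrn quat_eq0 /=.
case: x => a b c d /= /and4P[/eqP/Zp_mulrp_eq0[a' ->] /eqP/Zp_mulrp_eq0[b' ->]].
move=> /eqP/Zp_mulrp_eq0[c' ->] /eqP/Zp_mulrp_eq0[d' ->].
by exists (Quat a' b' c' d'); rewrite quat_mulrn.
Qed.

Lemma quat_mulrn_q (x : quaternion 'Z_(p ^ s)) : x *+ p ^ s = 0.
Proof.
have mulrn_q (a : 'Z_(p ^ s)) : a *+ p ^ s = 0.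
  by rewrite -mulr_natr pchar_Zp // mulr0.
by rewrite quat_mulrn !mulrn_q.
Qed.

(* The largest multiple [p ^ j * u] that does not vanish lies in the socle
   [p ^ (s - 1) * Q], on which [Q] acts through its reduction modulo [p]. *)
Lemma reduce_annihilator u : u != 0 -> exists w,
  [/\ w != 0, reduce u != 0 -> w = reduce u,
     forall v, v * u = 0 -> reduce v * w = 0 &
     forall v, u * v = 0 -> w * reduce v = 0].
Proof.
move=> u0; have [ru|ru] := eqVneq (reduce u) 0; last first.
  have reduce0 : reduce 0 = 0 by rewrite -(subrr 0) reduceB subrr.
  by exists (reduce u); split=> // v uv; rewrite -reduceM uv reduce0.
have ex_j : exists j, u *+ p ^ j == 0 by exists s; rewrite quat_mulrn_q.
case: (ex_minnP ex_j) => [[|j]]; first by rewrite expn0 mulr1n (negPf u0).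
(* By minimality [u *+ p ^ j] is nonzero, while [p] kills it; hence it is [y *+ p ^ s.-1] with
   [reduce y] nonzero. *)
rewrite expnSr mulrnA => /eqP /quat_mulrp_eq0[y uy] min_j.
exists (reduce y); split=> [||v vu|v uv].
- rewrite -quat_mulrn_eq0 -uy; apply/negP=> /min_j; by rewrite ltnn.
- by [].
- apply/eqP; rewrite -reduceM -quat_mulrn_eq0 -mulrnAr -uy mulrnAr vu.
  by rewrite mul0rn.
- apply/eqP; rewrite -reduceM -quat_mulrn_eq0 -mulrnAl -uy mulrnAl uv.
  by rewrite mul0rn.
Qed.

End Reduction.

(** * Vertices of the graph over Z/p^s and the two bounds *)

Lemma domination_number_eq (V : finType) (adj : rel V) n (S : {set V}) :
  dominating adj S -> #|S| = n ->
  (forall T : {set V}, dominating adj T -> (n <= #|T|)%N) ->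
  domination_number adj = n.
Proof.
move=> domS cardS minS; rewrite /domination_number.
case: arg_minnP => [|T domT minT]; first exact: dominating_setT.
by apply/eqP; rewrite eqn_leq minS // -cardS minT.
Qed.

Lemma quat_conj_neq0 (R : comNzRingType) (x : quaternion R) :
  x != 0 -> quat_conj x != 0.
Proof. by rewrite !quat_eq0 /= !oppr_eq0. Qed.

Section Vertices.

Variables p s : nat.
Hypotheses (p_prime : prime p) (s_gt0 : (0 < s)%N).

Local Notation Q := (quaternion 'Z_(p ^ s)).
Local Notation red := (@reduce p s).
Local Notation lift := (@qlift p s).

(** An annihilator of [v] yields one of its reduction; conversely, if [red v] kills [w], then [v]
    kills p^(s-1) times a lift of [w]. *)
Lemma nonzero_zero_divisorP (v : Q) :
  reflect (v != 0 /\ quat_norm (red v) = 0) (nonzero_zero_divisor v).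
Proof.
apply: (iffP andP) => -[v0 zv]; split=> //.
  case/orP: zv => /existsP[b /andP[/(reduce_annihilator p_prime s_gt0)[w [w0 _ wr wl]] /eqP vb]].
    exact: quat_norm_eq0_mulr w0 (wr _ vb).
  exact: quat_norm_eq0_mull w0 (wl _ vb).
apply/orP; left.
have ex_w : exists2 w, w != 0 & red v * w = 0.
  have [rv|rv] := eqVneq (red v) 0.
    by exists 1; rewrite ?oner_neq0 // rv mul0r.
  exists (quat_conj (red v)); first exact: quat_conj_neq0.
  by rewrite quat_mul_conj zv.
case: ex_w => w w0 vw.
apply/existsP; exists (lift w *+ p ^ s.-1).
rewrite mulrnAr !quat_mulrn_eq0 // reduceM // qliftK //.
by rewrite w0 vw eqxx.
Qed.

Hypothesis p_odd : odd p.

Local Notation V := (zero_divisor_vertex Q).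

Lemma small_not_dominating (S : {set V}) :
  dominating (@zero_divisor_adj Q) S -> (p < #|S|)%N.
Proof.
move=> /forallP domS; rewrite ltnNge; apply/negP=> cardS.
have [al [be al_be]] := Fp_sum_two_squares p_prime p_odd.
have [w wP] := fin_all_exists (fun u : V =>
  reduce_annihilator p_prime s_gt0 (nonzero_zero_divisorP _ (valP u)).1).
pose W := w @: S.
have [|| x [x0 nx xW xw]] := @ex_nonadjacent 'F_p al be W al_be (Fp_two_neq0 p_prime p_odd).
- by move=> _ /imsetP[u _ ->]; have [] := wP u.
- by rewrite card_Fp // (leq_trans (leq_imset_card _ _)).
have xV : nonzero_zero_divisor (lift x).
  apply/nonzero_zero_divisorP; rewrite qliftK //; split=> //.
  apply: contraNneq x0 => lx0; rewrite -(qliftK p_prime s_gt0 x) lx0.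
  by rewrite -quat_mulrn_eq0 // mul0rn.
pose v : V := Sub (lift x) xV.
(* The element attached to [v] is its nonzero reduction [x], so [v] in [S] would put [x] in [W]. *)
have vS : v \notin S.
  apply: contra xW => vS; apply/imsetP; exists v => //.
  by have [_ ->] := wP v; rewrite /= qliftK.
have /exists_inP[u uS /andP[_ vu]] := implyP (domS v) vS.
have [_ _ ul ur] := wP u.
have [|xu ux] := xw (w u); first by apply: imset_f.
case/orP: vu => /eqP => [/ul|/ur]; rewrite /= qliftK // => /eqP.
  by rewrite (negPf xu).
by rewrite (negPf ux).
Qed.

Lemma ex_dominating :
  exists2 S : {set V}, dominating (@zero_divisor_adj Q) S & #|S| = p.+1.
Proof.
have [al [be al_be]] := Fp_sum_two_squares p_prime p_odd.
have two_neq0 := Fp_two_neq0 p_prime p_odd.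
(* Only the image matters for being killed from the left, so the kernel is fixed as [None]. *)
pose e (M : option 'F_p) := line_map al be None M.
have lift_e M : red (lift (e M)) = e M by rewrite qliftK.
have t_vertex M : nonzero_zero_divisor (lift (e M) *+ p ^ s.-1).
  have t0 : lift (e M) *+ p ^ s.-1 != 0.
    by rewrite quat_mulrn_eq0 // lift_e line_map_neq0.
  apply/andP; split=> //; apply/orP; left; apply/existsP.
  (* Its image [None] is the kernel of every [e M]. *)
  exists (lift (line_map al be None None)).
  rewrite mulrnAl quat_mulrn_eq0 // reduceM // lift_e qliftK // line_map_mul_eq0 //.
  rewrite eqxx andbT; have := line_map_neq0 two_neq0 al_be None None.
  apply: contraNneq => l0; rewrite -[line_map _ _ _ _](qliftK p_prime s_gt0) l0.
  by rewrite -quat_mulrn_eq0 // mul0rn.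
pose t M : V := Sub (lift (e M) *+ p ^ s.-1) (t_vertex M).
have t_inj : injective t.
  move=> M M' /(congr1 val) /= /eqP; rewrite -subr_eq0 -mulrnBl quat_mulrn_eq0 //.
  by rewrite reduceB // !lift_e subr_eq0 => /eqP/(line_map_inj two_neq0 al_be)[].
exists (t @: [set: option 'F_p]); last first.
  by rewrite card_imset // cardsT card_option card_Fp.
apply/forallP=> v; apply/implyP=> vS.
have [_ nv] := nonzero_zero_divisorP _ (valP v).
have [M vM] := ex_mulr_line_map two_neq0 al_be None nv.
have tS : t M \in t @: [set: option 'F_p] by apply: imset_f.
apply/exists_inP; exists (t M) => //; apply/andP; split.
  by apply: contraNneq vS => ->.
by rewrite /= mulrnAr quat_mulrn_eq0 // reduceM // lift_e vM eqxx.
Qed.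

End Vertices.

Theorem theorem2p4 (p s : nat) (p_prime : prime p) (p_odd : odd p)
    (s_ge1 : (1 <= s)%N) :
  domination_number (@zero_divisor_adj (quaternion 'Z_(p ^ s))) = p.+1.
Proof.
have [S domS cardS] := ex_dominating p_prime s_ge1 p_odd.
apply: domination_number_eq domS cardS _ => T.
exact: small_not_dominating.
Qed.
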